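(* Let $\Bbbk$ be an algebraically closed field of characteristic zero, let $\lambda\in\Bbbk$ with $\lambda\neq0$, and let $\mathfrak U=\mathfrak U(\lambda)$ be the algebra presented in the context. A complete set of pairwise non-isomorphic finite-dimensional simple $\mathfrak U$-modules is $$\{[T_+(\gamma)]\mid\gamma\in\Bbbk\}\cup\{[T_-(\gamma)]\mid\gamma\in\Bbbk\},\qquad T_\pm(\gamma):=\mathfrak U/\langle x,\ g\mp1,\ y-\gamma\rangle.$$ Moreover, $\mathrm{ann}_{\mathfrak U}(T_\pm(\gamma))=\langle x,\ g\mp1,\ y-\gamma\rangle$. In particular, every finite-dimensional simple $\mathfrak U$-module is one-dimensional.
   Context: $\mathfrak U(\lambda)$ is the associative unital $\Bbbk$-algebra generated by $g^{\pm1},x,y$ with relations $gg^{-1}=g^{-1}g=1$, $gxg^{-1}=x$, $gyg^{-1}=y+x$, $yx-xy=-\tfrac12x^2+\lambda(1-g^2)$. Modules are left modules, $[M]$ denotes the isomorphism class of $M$, $\langle\mathcal S\rangle$ denotes the two-sided ideal generated by $\mathcal S$, and $\mathrm{ann}_{\mathfrak U}(M)=\{r\in\mathfrak U\mid rm=0\ \text{for all } m\in M\}$. *)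

(* Defs.v *)
From HB Require Import structures.
From mathcomp Require Import ssreflect ssrfun ssrbool eqtype ssrnat seq choice.
From mathcomp Require Import fintype finfun bigop generic_quotient.
From mathcomp Require Import ssralg matrix ring_quotient.
From mathcomp Require Import boolp classical_sets.
From mathcomp Require Import monalg.

Set Implicit Arguments.
Unset Strict Implicit.
Unset Printing Implicit Defensive.

Import GRing.Theory.
Local Open Scope ring_scope.
Local Open Scope classical_set_scope.

(* Two-sided ideals are Prop-valued subsets; the improper ideal is allowed. *)

Definition two_sided_ideal (R : pzRingType) (I : set R) : Prop :=
  [/\ I 0,
      forall a b, I a -> I b -> I (a + b),
      forall r a, I a -> I (r * a)
    & forall r a, I a -> I (a * r)].

Definition ideal_gen (R : pzRingType) (S : set R) : set R :=
  smallest (@two_sided_ideal R) S.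

Section IdealGen.
Variables (R : pzRingType) (S : set R).

Lemma ideal_gen_ideal : two_sided_ideal (ideal_gen S).
Proof.
split=> [I [[]] //|a b Ia Ib I II|r a Ia I II|r a Ia I II].
- by have [[_ + _ _] _] := II; apply; [apply: Ia|apply: Ib].
- by have [[_ _ + _] _] := II; apply; apply: Ia.
- by have [[_ _ _ +] _] := II; apply; apply: Ia.
Qed.

Definition ideal_pred (r : R) : bool := `[< ideal_gen S r >].

Lemma ideal_predP r : reflect (ideal_gen S r) (r \in ideal_pred).
Proof. exact: asboolP. Qed.

Lemma ideal_pred_zmod_closed : zmod_closed ideal_pred.
Proof.
have [I0 ID IMl _] := ideal_gen_ideal.
split=> [|a b /ideal_predP Ia /ideal_predP Ib]; apply/ideal_predP => //.
by apply: ID => //; rewrite -mulN1r; apply: IMl.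
Qed.

HB.instance Definition _ :=
  GRing.isZmodClosed.Build R ideal_pred ideal_pred_zmod_closed.

Definition ideal_zmod : zmodClosed R := GRing.ZmodClosed.clone R ideal_pred _.

Lemma ideal_predMl r a : a \in ideal_pred -> r * a \in ideal_pred.
Proof.
by have [_ _ IM _] := ideal_gen_ideal => /ideal_predP/IM ?; apply/ideal_predP.
Qed.

Lemma ideal_predMr r a : a \in ideal_pred -> a * r \in ideal_pred.
Proof.
by have [_ _ _ IM] := ideal_gen_ideal => /ideal_predP/IM ?; apply/ideal_predP.
Qed.

End IdealGen.

(* R / <S> appears below under two names, one per scalar action: quot_mod is *)
(* the left R-module, quot_alg the ring (a k-algebra if R is one).           *)

Section QuotMod.
Local Open Scope quotient_scope.
Variables (R : pzRingType) (S : set R).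

Definition quot_mod : Type := {ideal_quot (ideal_zmod S)}.

HB.instance Definition _ := GRing.Zmodule.on quot_mod.

Definition to_quot_mod (r : R) : quot_mod :=
  \pi_({ideal_quot (ideal_zmod S)}) r.

Lemma to_quot_mod_eq a b :
  to_quot_mod a = to_quot_mod b <-> ideal_gen S (a - b).
Proof.
split=> [/eqP ab|/ideal_predP ab]; last by apply/eqP; rewrite -Quotient.idealrBE.
by apply/ideal_predP; rewrite Quotient.idealrBE.
Qed.

Lemma to_quot_modK (u : quot_mod) : to_quot_mod (repr u) = u.
Proof. exact: reprK. Qed.

Lemma to_quot_mod_surj (u : quot_mod) : exists a, u = to_quot_mod a.
Proof. by exists (repr u); rewrite to_quot_modK. Qed.

Lemma to_quot_modD : {morph to_quot_mod : a b / a + b}.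
Proof. by move=> a b; exact: (Quotient.pi_add (ideal_zmod S) a b). Qed.

Lemma to_quot_mod0 : to_quot_mod 0 = 0.
Proof. by apply: (addrI (to_quot_mod 0)); rewrite -to_quot_modD !addr0. Qed.

Definition quot_mod_scale (r : R) (u : quot_mod) : quot_mod :=
  to_quot_mod (r * repr u).

Lemma quot_mod_scaleE r a :
  quot_mod_scale r (to_quot_mod a) = to_quot_mod (r * a).
Proof.
apply/to_quot_mod_eq; rewrite -mulrBr; apply/ideal_predP/ideal_predMl.
by apply/ideal_predP/to_quot_mod_eq/to_quot_modK.
Qed.

Let scaleA r s u : quot_mod_scale r (quot_mod_scale s u) = quot_mod_scale (r * s) u.
Proof. by rewrite -[u]to_quot_modK !quot_mod_scaleE mulrA. Qed.

Let scale1 : left_id 1 quot_mod_scale.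
Proof. by move=> u; rewrite -[u]to_quot_modK quot_mod_scaleE mul1r. Qed.

Let scaleDr : right_distributive quot_mod_scale +%R.
Proof.
move=> r u v; rewrite -[u]to_quot_modK -[v]to_quot_modK.
by rewrite -to_quot_modD !quot_mod_scaleE -to_quot_modD mulrDr.
Qed.

Let scaleDl u : {morph quot_mod_scale^~ u : r s / r + s}.
Proof.
move=> r s; rewrite -[u]to_quot_modK.
by rewrite !quot_mod_scaleE -to_quot_modD mulrDl.
Qed.

HB.instance Definition _ := GRing.Zmodule_isLmodule.Build R quot_mod
  scaleA scale1 scaleDr scaleDl.

End QuotMod.

Section QuotAlg.
Local Open Scope quotient_scope.
Variables (k : pzRingType) (A : algType k) (S : set A).

Definition quot_alg : Type := {ideal_quot (ideal_zmod S)}.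

HB.instance Definition _ := GRing.Zmodule.on quot_alg.

Definition to_quot_alg (a : A) : quot_alg :=
  \pi_({ideal_quot (ideal_zmod S)}) a.

Lemma to_quot_alg_eq a b :
  to_quot_alg a = to_quot_alg b <-> ideal_gen S (a - b).
Proof. exact: (@to_quot_mod_eq A S a b). Qed.

Lemma to_quot_algK (u : quot_alg) : to_quot_alg (repr u) = u.
Proof. exact: reprK. Qed.

Lemma to_quot_alg_surj (u : quot_alg) : exists a, u = to_quot_alg a.
Proof. by exists (repr u); rewrite to_quot_algK. Qed.

Lemma to_quot_algD : {morph to_quot_alg : a b / a + b}.
Proof. exact: (@to_quot_modD A S). Qed.

Lemma to_quot_alg0 : to_quot_alg 0 = 0.
Proof. by apply: (addrI (to_quot_alg 0)); rewrite -to_quot_algD !addr0. Qed.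

Definition quot_alg_mul (u v : quot_alg) : quot_alg :=
  to_quot_alg (repr u * repr v).

Lemma quot_alg_mulE a b :
  quot_alg_mul (to_quot_alg a) (to_quot_alg b) = to_quot_alg (a * b).
Proof.
have [_ ID _ _] := ideal_gen_ideal S.
apply/to_quot_alg_eq; set a' := repr _; set b' := repr _.
have -> : a' * b' - a * b = (a' - a) * b' + a * (b' - b).
  by rewrite mulrBl mulrBr addrA subrK.
apply: ID; apply/ideal_predP.
  by apply/ideal_predMr/ideal_predP/to_quot_alg_eq/to_quot_algK.
by apply/ideal_predMl/ideal_predP/to_quot_alg_eq/to_quot_algK.
Qed.

Let mulA : associative quot_alg_mul.
Proof.
move=> u v w; rewrite -[u]to_quot_algK -[v]to_quot_algK -[w]to_quot_algK.
by rewrite !quot_alg_mulE mulrA.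
Qed.

Let mul1q : left_id (to_quot_alg 1) quot_alg_mul.
Proof. by move=> u; rewrite -[u]to_quot_algK quot_alg_mulE mul1r. Qed.

Let mulq1 : right_id (to_quot_alg 1) quot_alg_mul.
Proof. by move=> u; rewrite -[u]to_quot_algK quot_alg_mulE mulr1. Qed.

Let mulqDl : left_distributive quot_alg_mul +%R.
Proof.
move=> u v w; rewrite -[u]to_quot_algK -[v]to_quot_algK -[w]to_quot_algK.
by rewrite -to_quot_algD !quot_alg_mulE -to_quot_algD mulrDl.
Qed.

Let mulqDr : right_distributive quot_alg_mul +%R.
Proof.
move=> u v w; rewrite -[u]to_quot_algK -[v]to_quot_algK -[w]to_quot_algK.
by rewrite -to_quot_algD !quot_alg_mulE -to_quot_algD mulrDr.
Qed.

HB.instance Definition _ := GRing.Zmodule_isPzRing.Build quot_alg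
  mulA mul1q mulq1 mulqDl mulqDr.

Definition quot_alg_scale (c : k) (u : quot_alg) : quot_alg :=
  to_quot_alg (c *: repr u).

Lemma quot_alg_scaleE c a :
  quot_alg_scale c (to_quot_alg a) = to_quot_alg (c *: a).
Proof.
apply/to_quot_alg_eq; rewrite -scalerBr -[_ - _]mul1r scalerAl.
by apply/ideal_predP/ideal_predMl/ideal_predP/to_quot_alg_eq/to_quot_algK.
Qed.

Let scaleA c d u : quot_alg_scale c (quot_alg_scale d u) = quot_alg_scale (c * d) u.
Proof. by rewrite -[u]to_quot_algK !quot_alg_scaleE scalerA. Qed.

Let scale1 : left_id 1 quot_alg_scale.
Proof. by move=> u; rewrite -[u]to_quot_algK quot_alg_scaleE scale1r. Qed.

Let scaleDr : right_distributive quot_alg_scale +%R.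
Proof.
move=> c u v; rewrite -[u]to_quot_algK -[v]to_quot_algK.
by rewrite -to_quot_algD !quot_alg_scaleE -to_quot_algD scalerDr.
Qed.

Let scaleDl u : {morph quot_alg_scale^~ u : c d / c + d}.
Proof.
move=> c d; rewrite -[u]to_quot_algK.
by rewrite !quot_alg_scaleE -to_quot_algD scalerDl.
Qed.

HB.instance Definition _ := GRing.Zmodule_isLmodule.Build k quot_alg
  scaleA scale1 scaleDr scaleDl.

Lemma to_quot_algM : {morph to_quot_alg : a b / a * b}.
Proof. by move=> a b; apply: esym; apply: quot_alg_mulE. Qed.

Lemma to_quot_alg1 : to_quot_alg 1 = 1.
Proof. by []. Qed.

Lemma to_quot_algZ c : {morph to_quot_alg : a / c *: a}.
Proof. by move=> a; apply: esym; apply: quot_alg_scaleE. Qed.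

Lemma quot_alg_scalerAl (c : k) (u v : quot_alg) : c *: (u * v) = c *: u * v.
Proof.
rewrite -[u]to_quot_algK -[v]to_quot_algK.
by rewrite -!(to_quot_algM, to_quot_algZ) scalerAl.
Qed.

Lemma quot_alg_scalerAr (c : k) (u v : quot_alg) : c *: (u * v) = u * (c *: v).
Proof.
rewrite -[u]to_quot_algK -[v]to_quot_algK.
by rewrite -!(to_quot_algM, to_quot_algZ) scalerAr.
Qed.

End QuotAlg.

Section FreeAlgebra.
Variables (k : comNzRingType) (X : choiceType).

Lemma malg_scalerAr (c : k) (a b : {malg k[{fmonom X}]}) :
  c *: (a * b) = a * (c *: b).
Proof.
have ca : c%:MP * a = a * c%:MP.
  rewrite !malgM_def fgmulUg fgmulgU; apply: eq_bigr => m _.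
  by rewrite mulrC mul1m mulm1.
transitivity (c%:MP * (a * b)); first by exact: esym (mul_malgC _ _).
transitivity (c%:MP * a * b); first by exact: mulrA.
transitivity (a * c%:MP * b); first by exact: (congr1 ( *%R^~ b) ca).
transitivity (a * (c%:MP * b)); first by exact: esym (mulrA _ _ _).
by exact: (congr1 ( *%R a) (mul_malgC _ _)).
Qed.

Definition free_alg : Type := {malg k[{fmonom X}]}.

HB.instance Definition _ := GRing.Lalgebra.on free_alg.

HB.instance Definition _ :=
  GRing.Lalgebra_isAlgebra.Build k free_alg malg_scalerAr.

Definition free_gen (i : X) : free_alg := << fmu i >>.

End FreeAlgebra.

Inductive U_gen := Gen_g | Gen_ginv | Gen_x | Gen_y.

HB.instance Definition _ := gen_eqMixin U_gen.
HB.instance Definition _ := gen_choiceMixin U_gen.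

Section Relations.
Variables (k : fieldType) (lambda : k) (A : algType k) (g g' x y : A).

Definition U_rel : set A :=
  [set g * g' - 1;
       g' * g - 1;
       g * x * g' - x;
       g * y * g' - (y + x);
       (y * x - x * y) - (- (2%:R^-1 *: x ^+ 2) + lambda *: (1 - g ^+ 2))].

Lemma U_rel_quot :
  let q := to_quot_alg U_rel in
  [/\ q g * q g' = 1, q g' * q g = 1, q g * q x * q g' = q x,
      q g * q y * q g' = q y + q x
    & q y * q x - q x * q y = - (2%:R^-1 *: q x ^+ 2) + lambda *: (1 - q g ^+ 2)].
Proof.
move=> q.
have qD a b : q (a + b) = q a + q b by exact: to_quot_algD.
have qM a b : q (a * b) = q a * q b by exact: to_quot_algM.
have qZ c a : q (c *: a) = c *: q a by exact: to_quot_algZ.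
have q1 : q 1 = 1 by [].
have qN a : q (- a) = - q a by rewrite -scaleN1r qZ scaleN1r.
have relP a b : U_rel (a - b) -> q a = q b.
  by move=> ab; apply/to_quot_alg_eq; apply: sub_gen_smallest.
split.
- by rewrite -q1 -qM; apply: relP; do 4 left.
- by rewrite -q1 -qM; apply: relP; left; left; left; right.
- by rewrite -!qM; apply: relP; left; left; right.
- by rewrite -!qM -qD; apply: relP; left; right.
have := relP (y * x - x * y) _ (or_intror erefl).
by rewrite !(qD, qN, qZ, qM) q1 expr2.
Qed.

Lemma U_rel_char (chi : {rmorphism A -> k}) :
    (forall c a, chi (c *: a) = c * chi a) ->
    chi g = 1 -> chi g' = 1 -> chi x = 0 -> chi y = 0 ->
  ~ ideal_gen U_rel 1.
Proof.
move=> chiZ g1 g'1 x0 y0 /(_ (chi @^-1` [set 0])).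
suff H : two_sided_ideal (chi @^-1` [set 0]) /\ U_rel `<=` chi @^-1` [set 0].
  by move=> /(_ H) /=; rewrite rmorph1 => /eqP; rewrite oner_eq0.
split.
  split=> [|a b|r a|r a] /=; rewrite ?(rmorph0, rmorphD, rmorphM) //.
  - by move=> -> ->; rewrite addr0.
  - by move=> ->; rewrite mulr0.
  - by move=> ->; rewrite mul0r.
by move=> r /= [[[[]|]|]|] ->;
  rewrite !(rmorphB, rmorphD, rmorphN, rmorphM, rmorphXn, rmorph1, chiZ);
  rewrite ?(g1, g'1, x0, y0, expr1n, expr0n);
  rewrite ?(mulr0, mul0r, mulr1, subrr, oppr0, addr0).
Qed.

End Relations.

Section U.
Variables (k : fieldType) (lambda : k).

Let F : algType k := free_alg k U_gen.

Definition U_ideal_rel : set F :=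
  U_rel lambda (free_gen k Gen_g) (free_gen k Gen_ginv)
    (free_gen k Gen_x) (free_gen k Gen_y).

Definition U : Type := quot_alg U_ideal_rel.

HB.instance Definition _ := GRing.PzRing.on U.
HB.instance Definition _ := GRing.Lmodule.on U.

(* U is nonzero: it has the character g, g^-1 |-> 1 and x, y |-> 0. *)

Let chi_gen (i : U_gen) : k :=
  match i with Gen_g | Gen_ginv => 1 | Gen_x | Gen_y => 0 end.

Let chi_monom (m : {fmonom U_gen}) : k := \prod_(i <- (m : seq U_gen)) chi_gen i.

Let chi_monomM : mmorphism chi_monom.
Proof.
by split=> [m n|]; rewrite /chi_monom ?fmM ?fm1 ?big_cat ?big_nil.
Qed.

HB.instance Definition _ := isMultiplicative.Build _ _ chi_monom chi_monomM.

Lemma U_oner_neq0 : 1 != 0 :> U.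
Proof.
pose chi : {rmorphism F -> k} := mmap idfun chi_monom.
have chiE i : chi (free_gen k i) = chi_gen i.
  by rewrite /chi /= mmapU /chi_monom fmU big_seq1 mul1r.
apply/eqP => U10; apply: (@U_rel_char _ lambda F _ _ _ _ chi _
  (chiE Gen_g) (chiE Gen_ginv) (chiE Gen_x) (chiE Gen_y)).
  by move=> c a; exact: mmap_is_linear.
rewrite -[1]subr0; apply/to_quot_alg_eq; rewrite to_quot_alg0; exact: U10.
Qed.

HB.instance Definition _ := GRing.PzSemiRing_isNonZero.Build U U_oner_neq0.
HB.instance Definition _ := GRing.Lmodule_isLalgebra.Build k U
  (@quot_alg_scalerAl k F U_ideal_rel).
HB.instance Definition _ := GRing.Lalgebra_isAlgebra.Build k U
  (@quot_alg_scalerAr k F U_ideal_rel).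

Definition Ug : U := to_quot_alg U_ideal_rel (free_gen k Gen_g).
Definition Uginv : U := to_quot_alg U_ideal_rel (free_gen k Gen_ginv).
Definition Ux : U := to_quot_alg U_ideal_rel (free_gen k Gen_x).
Definition Uy : U := to_quot_alg U_ideal_rel (free_gen k Gen_y).

Lemma U_relations :
  [/\ Ug * Uginv = 1, Uginv * Ug = 1, Ug * Ux * Uginv = Ux,
      Ug * Uy * Uginv = Uy + Ux
    & Uy * Ux - Ux * Uy = - (2%:R^-1 *: Ux ^+ 2) + lambda *: (1 - Ug ^+ 2)].
Proof. exact: U_rel_quot. Qed.

(* The sign is the boolean s: T_+ is s = false and T_- is s = true. *)

Definition T_rel (s : bool) (gamma : k) : set U :=
  [set Ux; Ug - (-1) ^+ s; Uy - gamma%:A].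

Definition T_mod (s : bool) (gamma : k) : lmodType U := quot_mod (T_rel s gamma).

End U.

Arguments T_rel {k} lambda s gamma.
Arguments T_mod {k} lambda s gamma.

Section Modules.
Variable R : pzRingType.

Definition submodule (M : lmodType R) (N : set M) : Prop :=
  [/\ N 0, forall u v, N u -> N v -> N (u + v) & forall r v, N v -> N (r *: v)].

Definition simple_module (M : lmodType R) : Prop :=
  (exists v : M, v != 0) /\
  forall N : set M, submodule N -> N = [set 0] \/ N = [set: M].

Definition isomorphic (M N : lmodType R) : Prop :=
  exists f : {linear M -> N}, bijective f.

Definition annihilator (M : lmodType R) : set R :=
  [set r | forall m : M, r *: m = 0].

End Modules.

(* Dimension over k of a module over a k-algebra A; c : k acts as c%:A. *)

Definition has_dim (k : fieldType) (A : algType k) (M : lmodType A) (n : nat) :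
    Prop :=
  exists b : 'I_n -> M, forall v : M,
    exists! c : {ffun 'I_n -> k}, v = \sum_i (c i)%:A *: b i.

Definition finite_dim (k : fieldType) (A : algType k) (M : lmodType A) : Prop :=
  exists n, has_dim M n.

(* Main.v *)
Require Import Defs.
From HB Require Import structures.
From mathcomp Require Import ssreflect ssrfun ssrbool eqtype ssrnat seq choice.
From mathcomp Require Import fintype finfun bigop generic_quotient ssralg.
From mathcomp Require Import boolp classical_sets.
From mathcomp Require Import poly matrix mxpoly monalg.

(** A finite-dimensional simple module [M] turns out to be a module over the
    commutative algebra [U / <x, 1 - g^2>], which forces it to be a line.

    The relations say that the commutators of [y] with [g] and with [x] are
    [-xg] and [-x^2/2 + lambda (1 - g^2)], and each of them commutes with the
    element, [g] or [x], that it comes from.  In characteristic zero a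
    commutator [ad y t] that commutes with [t] is nilpotent on
    finite-dimensional modules ([nilpotent_ad]).  As [g] is invertible, some
    nonzero vector of [M] is killed by [x], and then, as [lambda != 0], some
    nonzero vector is killed by [x] and by [1 - g^2] together
    ([x_g2_kernel_neq0]).  The vectors killed by both form a submodule, so by
    simplicity [x = 0] and [g^2 = 1] on [M].  Now [g] and [y] commute on [M]
    with every generator; [g] has an eigenvector of eigenvalue [1] or [-1], [y]
    has one since the field is algebraically closed, and by [central_scalar]
    both act as scalars.  So [M] is killed by [T_rel s gamma] for suitable [s]
    and [gamma] ([simple_annihilated_by_T_rel]), whence [M] is isomorphic to
    [T_mod s gamma] ([simple_isomorphic_T]).

    Conversely the scalars [(-1)^s], [0], [gamma] satisfy the relations of [U]
    and define a character whose kernel is the ideal of [T_rel s gamma]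
    ([T_ideal_char]).  Therefore [T_mod s gamma] is a line, its annihilator is
    that ideal, and the ideal determines [s] and [gamma]. *)

Set Implicit Arguments.
Unset Strict Implicit.
Unset Printing Implicit Defensive.

Import GRing.Theory.
Local Open Scope ring_scope.
Local Open Scope classical_set_scope.

(** * Commutators modulo an ideal *)

Section Ad.
Variable R : pzRingType.
Implicit Types y a b : R.

Definition ad y a := y * a - a * y.

Lemma ad_is_additive y : {morph ad y : a b / a + b}.
Proof. by move=> a b; rewrite /ad mulrDr mulrDl opprD addrACA. Qed.

Lemma adM y a b : ad y (a * b) = ad y a * b + a * ad y b.
Proof. by rewrite /ad mulrBl mulrBr !mulrA addrA subrK. Qed.

Lemma mul_ad y a : y * a = a * y + ad y a.
Proof. by rewrite /ad addrC subrK. Qed.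

Lemma adC y a : ad y a = - ad a y.
Proof. by rewrite /ad opprB. Qed.

Lemma ad_comm y a : GRing.comm y a -> ad y a = 0.
Proof. by rewrite /ad => ->; rewrite subrr. Qed.

Lemma ad_inverse y a a' :
  a * a' = 1 -> a' * a = 1 -> ad y a' = - (a' * ad y a * a').
Proof.
move=> aa' a'a; rewrite /ad mulrBr mulrBl opprB !mulrA a'a mul1r.
by rewrite -!mulrA aa' mulr1.
Qed.

End Ad.

(** Under the commutation hypothesis, [ad y] acts on polynomials in [t] by the
    chain rule. *)
Lemma ad_horner (k : comNzRingType) (A : algType k) (y t : A) (p : {poly k}) :
    GRing.comm t (ad y t) ->
  ad y (horner_alg t p) = horner_alg t p^`() * ad y t.
Proof.
move=> ct; elim/poly_ind: p => [|p c IHp].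
  by rewrite deriv0 !rmorph0 mul0r /ad mulr0 mul0r subrr.
rewrite derivD derivM derivX derivC mulr1 addr0.
rewrite !(rmorphD, rmorphM) /= horner_algX horner_algC ad_is_additive adM IHp.
have ->: ad y c%:A = 0 by rewrite /ad -scalerAl -scalerAr mulr1 mul1r subrr.
by rewrite addr0 mulrDl -!mulrA -ct.
Qed.

Lemma deriv_neq0 (k : fieldType) (p : {poly k}) :
  [pchar k] =i pred0 -> (1 < size p)%N -> p^`() != 0.
Proof.
move=> char_k p_gt1; apply/eqP.
move=> /(congr1 (fun q : {poly k} => q`_(size p).-2)).
rewrite coef_deriv coef0 => /eqP.
rewrite -mulr_natr mulf_eq0 (pcharf0P k).1 // orbF.
have -> : (size p).-2.+1 = (size p).-1 by case: (size p) p_gt1 => [|[]].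
by rewrite lead_coef_eq0 -size_poly_eq0 eqn0Ngt ltnW.
Qed.

(** An algebraic form of the Kleinecke-Shirokov theorem.  Put [w := ad y t].
    Applying the derivation [ad y] to [p(t) w^n], which lies in [I], and
    multiplying by [w^n] on the left puts [p'(t) w^(2n+1)] in [I]: the other
    Leibniz term is a multiple of [w^n p(t) = p(t) w^n].  In characteristic zero
    repeated differentiation makes [p] a nonzero constant. *)
Lemma nilpotent_ad (k : fieldType) (A : algType k) (I : set A) (y t : A)
    (p : {poly k}) :
    [pchar k] =i pred0 -> two_sided_ideal I -> GRing.comm t (ad y t) ->
    p != 0 -> I (horner_alg t p) ->
  exists n, I (ad y t ^+ n).
Proof.
move=> char_k [I0 ID IMl IMr] ct p_neq0 Ip.
have IB a b : I a -> I b -> I (a - b).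
  by move=> Ia Ib; apply: ID => //; rewrite -mulN1r; apply: IMl.
set w := ad y t in ct *.
have cp (q : {poly k}) : GRing.comm w (horner_alg t q).
  elim/poly_ind: q => [|q c IHq]; first by rewrite rmorph0; apply: commr0.
  rewrite rmorphD rmorphM /= horner_algX horner_algC.
  apply: commrD; first by apply: commrM => //; apply: commr_sym.
  by rewrite /GRing.comm -scalerAl -scalerAr mulr1 mul1r.
have: I (horner_alg t p * w ^+ 0) by rewrite expr0 mulr1.
have [m] := ubnP (size p); move: 0%N => n.
elim: m p n p_neq0 {Ip} => // m IHm p n p_neq0 lt_pm Ipw.
have [p_le1|p_gt1] := leqP (size p) 1.
  exists n; move: Ipw; rewrite (size1_polyC p_le1) /= horner_algC.
  have c_neq0 : p`_0 != 0 by rewrite -polyC_eq0 -size1_polyC.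
  move=> /(IMl (p`_0)^-1%:A).
  by rewrite mulrA -scalerAl mul1r scalerA mulVf // scale1r mul1r.
apply: (IHm p^`() (n + 1 + n)%N).
- exact: deriv_neq0.
- exact: leq_trans (lt_size_deriv p_neq0) _.
(* The exponent [2n+1] collects [w^n] from either side and the factor [w]
   coming from the derivative of [p(t)]. *)
have -> : horner_alg t p^`() * w ^+ (n + 1 + n) =
    w ^+ n * ad y (horner_alg t p * w ^+ n)
      - horner_alg t p * w ^+ n * ad y (w ^+ n).
  have cwn : GRing.comm (w ^+ n) (horner_alg t p).
    by apply/commr_sym/commrX/commr_sym.
  have cwn' : GRing.comm (w ^+ n) (horner_alg t p^`()).
    by apply/commr_sym/commrX/commr_sym.
  rewrite adM mulrDr ad_horner // [w ^+ n * (horner_alg t p * _)]mulrA cwn.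
  rewrite addrK.
  by rewrite !exprD expr1 !mulrA cwn'.
apply: (IB); last exact: IMr.
by apply/IMl/IB; [apply: IMl|apply: IMr].
Qed.

Section AdIdeal.
Variables (R : pzRingType) (J : set R).
Hypothesis idealJ : two_sided_ideal J.
Implicit Types r a : R.

Let JN a : J a -> J (- a).
Proof. by have [_ _ JMl _] := idealJ; rewrite -mulN1r; apply: JMl. Qed.

Lemma ad_ideal r a : J a -> J (ad r a).
Proof.
by have [_ JD JMl JMr] := idealJ => Ja; apply/JD/JN/JMr => //; apply: JMl.
Qed.

Lemma ad_idealC r a : J (ad r a) -> J (ad a r).
Proof. by move=> Ja; rewrite adC; apply: JN. Qed.

Lemma ad_idealV r a a' : a * a' = 1 -> a' * a = 1 -> J (ad r a) -> J (ad r a').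
Proof.
have [_ _ JMl JMr] := idealJ => aa' a'a Ja.
by rewrite (ad_inverse _ aa' a'a); apply/JN/JMr/JMl.
Qed.

Lemma ad_ideal_self r : J (ad r r).
Proof. by have [J0 _ _ _] := idealJ; rewrite ad_comm. Qed.

End AdIdeal.

(** Commutation with [r] modulo an ideal can thus be tested on algebra
    generators. *)
Lemma ad_mod_subalgebra (k : fieldType) (A : algType k) (J : set A) (r : A)
    (P := fun u => J (ad r u)) :
    two_sided_ideal J ->
  [/\ forall u v, P u -> P v -> P (u + v),
      forall u v, P u -> P v -> P (u * v) & forall c : k, P c%:A].
Proof.
rewrite {}/P => [[J0 JD JMl JMr]]; split=> [u v Ju Jv|u v Ju Jv|c].
- by rewrite ad_is_additive; apply: JD.
- by rewrite adM; apply: JD; [apply: JMr|apply: JMl].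
- by rewrite /ad -scalerAl -scalerAr mulr1 mul1r subrr.
Qed.

(** * Modules over an algebra *)

Lemma annihilator_ideal (R : pzRingType) (M : lmodType R) :
  two_sided_ideal (annihilator M).
Proof.
split=> [m|a b Ia Ib m|r a Ia m|r a Ia m]; first exact: scale0r.
- by rewrite scalerDl Ia Ib addr0.
- by rewrite -scalerA Ia scaler0.
- by rewrite -scalerA Ia.
Qed.

Lemma isomorphic_annihilator (R : pzRingType) (M N : lmodType R) :
  isomorphic M N -> annihilator M = annihilator N.
Proof.
move=> [f [h fK hK]]; apply/seteqP; split=> r rM m.
  by rewrite -[m]hK -linearZ rM linear0.
by rewrite -[r *: m]fK linearZ_LR rM -(linear0 f) fK.
Qed.

Lemma scaleB_eq0 (R : pzRingType) (M : lmodType R) (a b : R) (v : M) :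
  (a - b) *: v = 0 -> a *: v = b *: v.
Proof. by move/eqP; rewrite scalerBl subr_eq0 => /eqP. Qed.

Lemma scale_scalarC (k : fieldType) (A : algType k) (M : lmodType A)
    (a : A) (c : k) (v : M) :
  a *: (c%:A *: v) = c%:A *: (a *: v).
Proof. by rewrite !scalerA -scalerAl -scalerAr mulr1 mul1r. Qed.

Lemma scalarK (k : fieldType) (A : algType k) (M : lmodType A) (c : k) (v : M) :
  c != 0 -> c^-1%:A *: (c%:A *: v) = v.
Proof.
by move=> c0; rewrite scalerA -scalerAl mul1r scalerA mulVf // !scale1r.
Qed.

Lemma scalar_eq0 (k : fieldType) (A : algType k) (M : lmodType A) (c : k)
    (v : M) :
  v != 0 -> c%:A *: v = 0 -> c = 0.
Proof.
move=> v_neq0 cv; apply/eqP; apply: contraNT v_neq0 => /(scalarK v) <-.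
by rewrite cv scaler0.
Qed.

Lemma simple_cyclic (R : pzRingType) (M : lmodType R) (v : M) :
  simple_module M -> v != 0 -> forall m, exists r, m = r *: v.
Proof.
move=> [_ simM] v_neq0 m.
have [|N0|NT] := simM [set m | exists r, m = r *: v].
- split=> [|_ _ [r ->] [t ->]|t _ [r ->]].
  + by exists 0; rewrite scale0r.
  + by exists (r + t); rewrite scalerDl.
  + by exists (t * r); rewrite scalerA.
- have : [set m | exists r, m = r *: v] v by exists 1; rewrite scale1r.
  by rewrite N0 => /eqP; rewrite (negPf v_neq0).
by have : [set: M] m by []; rewrite -NT.
Qed.

Lemma line_simple_dim1 (k : fieldType) (A : algType k) (M : lmodType A)
    (v : M) :
    v != 0 -> (forall m, exists c : k, m = c%:A *: v) ->
  simple_module M /\ has_dim M 1.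
Proof.
move=> v_neq0 vP; split.
  split; first by exists v.
  move=> N [N0 _ NZ].
  have [[m [Nm m_neq0]]|noN] := pselect (exists m, N m /\ m != 0).
    right; apply/seteqP; split=> // m' _.
    have [c mE] := vP m; have [c' ->] := vP m'; apply: (NZ).
    have c_neq0 : c != 0.
      by apply: contraNneq m_neq0 => c0; rewrite mE c0 !scale0r.
    by rewrite -(scalarK v c_neq0) -mE; apply: NZ.
  left; apply/seteqP; split=> [m Nm|m -> //].
  by apply/eqP; apply: contrapT => /negP m_neq0; apply: noN; exists m.
exists (fun=> v) => m; have [c ->] := vP m; exists [ffun=> c].
split=> [|d]; rewrite big_ord1 ?ffunE // => cd.
apply/ffunP => i; rewrite ord1 ffunE; apply/eqP; rewrite -subr_eq0.
apply: contraNT v_neq0 => /(scalarK v) <-.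
by rewrite scalerBl scalerBl cd subrr scaler0.
Qed.

(** Schur's lemma in the form needed here: an element central modulo the
    annihilator and having one eigenvector acts as a scalar, because that vector
    generates the module. *)
Lemma central_scalar (k : fieldType) (A : algType k) (M : lmodType A) (r : A)
    (c : k) (w : M) :
    simple_module M -> (forall u, annihilator M (ad r u)) ->
    w != 0 -> r *: w = c%:A *: w ->
  annihilator M (r - c%:A).
Proof.
move=> simM rC w_neq0 rw m; have [u ->] := simple_cyclic simM w_neq0 m.
rewrite scalerBl scalerA mul_ad scalerDl [ad r u *: w]rC addr0 -scalerA rw.
by rewrite !scalerA -scalerAl -scalerAr mul1r mulr1 subrr.
Qed.

(** Cayley-Hamilton, applied to the matrix of the action of [r] in a basis. *)
Lemma algebraic_finite_dim (k : fieldType) (A : algType k) (M : lmodType A)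
    (r : A) :
    finite_dim M ->
  exists2 p : {poly k}, p != 0 & annihilator M (horner_alg r p).
Proof.
move=> [[|n] [b bP]].
  (* In dimension [0] the constant polynomial [1] annihilates. *)
  exists 1; rewrite ?oner_neq0 // => m.
  have all0 (v : M) : v = 0 by have [c [-> _]] := bP v; rewrite big_ord0.
  by rewrite [LHS]all0.
have [B BP] : exists B : 'M[k]_n.+1,
    forall i, r *: b i = \sum_j (B i j)%:A *: b j.
  have /choice [c cP] : forall i, exists c : {ffun 'I_n.+1 -> k},
      r *: b i = \sum_j (c j)%:A *: b j.
    by move=> i; have [c [cE _]] := bP (r *: b i); exists c.
  exists (\matrix_(i, j) c i j) => i; rewrite cP.
  by apply: eq_bigr => j _; rewrite mxE.
have actE (p : {poly k}) i :
    horner_alg r p *: b i = \sum_j (horner_mx B p i j)%:A *: b j.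
  elim/poly_ind: p i => [|p c IHp] i.
    rewrite !rmorph0 scale0r big1 // => j _.
    by rewrite mxE !scale0r.
  have -> : horner_mx B (p * 'X + c%:P) = B * horner_mx B p + c%:M.
    by rewrite mulrC rmorphD rmorphM /= horner_mx_X horner_mx_C.
  have actB l : horner_alg r p *: ((B i l)%:A *: b l)
      = \sum_j (B i l * horner_mx B p l j)%:A *: b j.
    rewrite scale_scalarC IHp scaler_sumr; apply: eq_bigr => j _.
    by rewrite scalerA -scalerAl mul1r scalerA.
  have -> : horner_alg r (p * 'X + c%:P) *: b i
      = \sum_l horner_alg r p *: ((B i l)%:A *: b l) + c%:A *: b i.
    rewrite rmorphD rmorphM /= horner_algX horner_algC scalerDl -scalerA BP.
    by rewrite scaler_sumr.
  rewrite (eq_bigr _ (fun l _ => actB l)) exchange_big /=.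
  have -> : c%:A *: b i = \sum_j ((c%:M : 'M_n.+1) i j)%:A *: b j.
    rewrite (bigD1 i) //= big1 ?addr0 => [|j ji].
      by rewrite mxE eqxx.
    by rewrite mxE eq_sym (negPf ji) !scale0r.
  rewrite -big_split; apply: eq_bigr => j _ /=.
  rewrite -scaler_suml -scaler_suml -scalerDl -scalerDl.
  by rewrite !mxE.
exists (char_poly B) => [|m]; first exact/monic_neq0/char_poly_monic.
have [c [-> _]] := bP m; rewrite scaler_sumr big1 // => i _.
rewrite scale_scalarC actE Cayley_Hamilton big1 ?scaler0 // => j _.
by rewrite mxE !scale0r.
Qed.

Lemma nilpotent_kernel_vector (R : pzRingType) (M : lmodType R) (r : R)
    (n : nat) (v : M) :
    v != 0 -> r ^+ n *: v = 0 ->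
  exists j, r ^+ j *: v != 0 /\ r *: (r ^+ j *: v) = 0.
Proof.
move=> v_neq0; elim: n => [|n IHn].
  by rewrite scale1r => /eqP; rewrite (negPf v_neq0).
have [/eqP/IHn //|rnv] := boolP (r ^+ n *: v == 0).
by rewrite exprS -scalerA; exists n.
Qed.

(** Write [p] as a product of linear factors and apply them to [v] one after
    another: the last nonzero vector obtained is an eigenvector. *)
Lemma eigenvector (k : closedFieldType) (A : algType k) (M : lmodType A)
    (r : A) (v : M) (p : {poly k}) :
    v != 0 -> p != 0 -> horner_alg r p *: v = 0 ->
  exists (c : k) (w : M), w != 0 /\ r *: w = c%:A *: w.
Proof.
have [m] := ubnP (size p).
elim: m p v => // m IHm p v lt_pm v_neq0 p_neq0 pv.
have [p1|p1] := boolP (size p == 1%N).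
  move: pv; rewrite (size1_polyC (eq_leq (eqP p1))) horner_algC.
  move=> /(scalar_eq0 v_neq0)/eqP.
  by rewrite -polyC_eq0 -size1_polyC ?(eqP p1) // (negPf p_neq0).
have [c /factor_theorem [q pE]] := closed_rootP _ p1.
have q_neq0 : q != 0 by apply: contraNneq p_neq0 => q0; rewrite pE q0 mul0r.
pose w := (r - c%:A) *: v.
have [/eqP w0|w_neq0] := boolP (w == 0).
  by exists c, v; split=> //; apply/eqP; rewrite -subr_eq0 -scalerBl -/w w0.
apply: (IHm q w) => //.
  by move: lt_pm; rewrite pE size_Mmonic ?monicXsubC // size_XsubC addn2 ltnS.
by move: pv; rewrite pE rmorphM rmorphB /= horner_algX horner_algC -scalerA.
Qed.

(** * Signs, characters and kernels *)

Lemma sign_scalar (k : pzRingType) (A : algType k) (s : bool) :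
  ((-1) ^+ s)%:A = (-1) ^+ s :> A.
Proof. by case: s; rewrite ?expr0 ?scale1r ?expr1 ?scaleN1r. Qed.

Lemma sign_inj (k : fieldType) :
  [pchar k] =i pred0 -> injective (fun s : bool => (-1) ^+ s : k).
Proof.
move=> char_k; have m1 : -1 != 1 :> k.
  by rewrite eq_sym -addr_eq0 -mulr2n (pcharf0P k).1.
by move=> [] [] // e; case/eqP: m1; [exact: e|exact: esym e].
Qed.

Lemma rmorphB_eq0 (R S : pzRingType) (chi : {rmorphism R -> S}) (a b : R) :
  chi (a - b) = 0 -> chi a = chi b.
Proof. by move/eqP; rewrite rmorphB subr_eq0 => /eqP. Qed.

Lemma rmorph_inverse_sign (R S : pzRingType) (chi : {rmorphism R -> S})
    (g g' : R) (s : bool) :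
  g * g' = 1 -> chi g = (-1) ^+ s -> chi g' = (-1) ^+ s.
Proof.
move=> gg' chig; have := congr1 ( *%R ((-1) ^+ s) \o chi) gg'.
by rewrite /= rmorphM rmorph1 chig mulrA -expr2 sqrr_sign mul1r mulr1.
Qed.

Lemma inverse_sub_sign (R : pzRingType) (J : set R) (g g' : R) (s : bool) :
    two_sided_ideal J -> g' * g = 1 ->
  J (g - (-1) ^+ s) -> J (g' - (-1) ^+ s).
Proof.
move=> [_ _ JMl JMr] g'g Jg.
suff -> : g' - (-1) ^+ s = - g' * (g - (-1) ^+ s) * (-1) ^+ s.
  by apply/JMr/JMl.
by rewrite mulNr mulrBr g'g opprB mulrBl mul1r -mulrA -expr2 sqrr_sign mulr1.
Qed.

Lemma kernel_ideal (R S : pzRingType) (chi : {rmorphism R -> S}) :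
  two_sided_ideal [set a | chi a = 0].
Proof.
split=> [|u v|u v|u v] /=; rewrite ?(rmorph0, rmorphD, rmorphM) //.
- by move=> -> ->; rewrite addr0.
- by move=> ->; rewrite mulr0.
- by move=> ->; rewrite mul0r.
Qed.

(** Whether every element is congruent modulo [J] to the scalar given by [chi]
    can thus be tested on algebra generators. *)
Lemma mod_char_subalgebra (k : fieldType) (A : algType k) (J : set A)
    (chi : {rmorphism A -> k}) (P := fun u => J (u - (chi u)%:A)) :
    (forall c : k, chi c%:A = c) -> two_sided_ideal J ->
  [/\ forall u v, P u -> P v -> P (u + v),
      forall u v, P u -> P v -> P (u * v) & forall c : k, P c%:A].
Proof.
rewrite {}/P => chiC [J0 JD JMl JMr]; split=> [u v Ju Jv|u v Ju Jv|c].
- by rewrite rmorphD scalerDl opprD addrACA; apply: JD.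
- rewrite rmorphM.
  have -> : u * v - (chi u * chi v)%:A
      = (u - (chi u)%:A) * v + (chi u)%:A * (v - (chi v)%:A).
    by rewrite mulrBl mulrBr addrA subrK -!scalerAl !mul1r scalerA.
  by apply: JD; [apply: JMr|apply: JMl].
- by rewrite chiC subrr.
Qed.

Lemma U_rel_sub_kernel (k : fieldType) (lambda : k) (A : algType k)
    (g g' x y : A) (chi : {rmorphism A -> k}) (s : bool) :
    (forall (c : k) (a : A), chi (c *: a) = c * chi a) ->
    chi g = (-1) ^+ s -> chi g' = (-1) ^+ s -> chi x = 0 ->
  U_rel lambda g g' x y `<=` [set a | chi a = 0].
Proof.
move=> chiZ chig chig' chix.
have sg2 : (-1) ^+ s * (-1) ^+ s = 1 :> k by rewrite -expr2 sqrr_sign.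
move=> r /= [[[[]|]|]|] ->;
  rewrite !(rmorphB, rmorphD, rmorphN, rmorphM, rmorphXn, rmorph1, chiZ);
  rewrite ?(chig, chig', chix) ?sqrr_sign ?sg2 ?expr0n /=;
  rewrite ?(mulr0, mul0r, subrr) //.
  by rewrite mulrAC sg2 mul1r addr0 subrr.
by rewrite !(oppr0, addr0).
Qed.

(** * Generators and characters of the algebra *)

Section FreeAlgebraInduction.
Variables (k : comNzRingType) (X : choiceType).

Let F : algType k := free_alg k X.

Let fmuM (m n : {fmonom X}) : << mmul m n >> = << m >> * << n >> :> F.
Proof. by rewrite malgM_def fgmulUU mulr1. Qed.

(** The free algebra is spanned by monomials, and these are products of
    generators. *)
Lemma free_alg_ind (P : set F) :
    (forall a b, P a -> P b -> P (a + b)) ->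
    (forall a b, P a -> P b -> P (a * b)) ->
    (forall c, P c%:A) -> (forall i, P (free_gen k i)) ->
  forall a, P a.
Proof.
move=> PD PM PC Pgen a.
have P0 : P 0 by rewrite -(scale0r 1); apply: PC.
have Pm (m : {fmonom X}) : P << m >>.
  case: m => s; elim: s => [|i s IHs].
    by have := PC 1; rewrite scale1r; congr P; rewrite -fmE.
  have -> : FMonom (i :: s) = mmul (fmu i) (FMonom s).
    by apply/eqP; rewrite fmP fmM fmU.
  by rewrite fmuM; apply: PM => //; apply: (Pgen i).
rewrite [a]monalgE; apply: (big_ind P) => // m _.
suff -> : << a@_m *g m >> = (a@_m)%:A * << m >> :> F by apply: PM.
rewrite -scalerAl mul1r; apply/malgP => n.
rewrite mcoeffU; apply: etrans (esym (mcoeffZ _ _ _)).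
by rewrite mcoeffU mulrnAr mulr1.
Qed.

End FreeAlgebraInduction.

Section Presentation.
Variables (k : fieldType) (lambda : k).

Let F : algType k := free_alg k U_gen.
Let q : F -> U lambda := to_quot_alg (U_ideal_rel lambda).

Lemma U_ind (P : set (U lambda)) :
    (forall u v, P u -> P v -> P (u + v)) ->
    (forall u v, P u -> P v -> P (u * v)) ->
    (forall c, P c%:A) ->
    P (Ug lambda) -> P (Uginv lambda) -> P (Ux lambda) -> P (Uy lambda) ->
  forall u, P u.
Proof.
move=> PD PM PC Pg Pg' Px Py u; have [a ->] := to_quot_alg_surj u.
apply: (@free_alg_ind _ _ (P \o q)) a => [a b /= Pa Pb|a b /= Pa Pb|c /=|[]] //.
- by rewrite /q to_quot_algD; apply: PD.
- by rewrite /q to_quot_algM; apply: PM.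
- by rewrite /q to_quot_algZ to_quot_alg1; apply: PC.
Qed.

Lemma U_submodule (M : lmodType (U lambda)) (N : set M) :
    N 0 -> (forall u v, N u -> N v -> N (u + v)) ->
    (forall (c : k) v, N v -> N (c%:A *: v)) ->
    (forall v, N v -> N (Ug lambda *: v)) ->
    (forall v, N v -> N (Uginv lambda *: v)) ->
    (forall v, N v -> N (Ux lambda *: v)) ->
    (forall v, N v -> N (Uy lambda *: v)) ->
  submodule N.
Proof.
move=> N0 ND NC Ng Ng' Nx Ny; split=> // r.
apply: (@U_ind (fun r => forall v, N v -> N (r *: v))) r => //.
- by move=> u v Nu Nv w Nw; rewrite scalerDl; apply: ND; auto.
- by move=> u v Nu Nv w Nw; rewrite -scalerA; auto.
Qed.

Section Character.
Variables (s : bool) (gamma : k).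

Definition T_char_gen (i : U_gen) : k :=
  match i with
  | Gen_g | Gen_ginv => (-1) ^+ s
  | Gen_x => 0
  | Gen_y => gamma
  end.

Let chi_monom (m : {fmonom U_gen}) : k :=
  \prod_(i <- (m : seq U_gen)) T_char_gen i.

Let chi_monomM : mmorphism chi_monom.
Proof.
by split=> [m n|]; rewrite /chi_monom ?fmM ?fm1 ?big_cat ?big_nil.
Qed.

HB.instance Definition _ := isMultiplicative.Build _ _ chi_monom chi_monomM.

(** The quotient defining [T_mod] is nonzero only because this character exists:
    the defining relations hold for the scalars [(-1)^s], [0], [gamma].  It is
    built on the free algebra and descends through representatives. *)
Lemma T_char_exists : exists chi : {rmorphism U lambda -> k},
  [/\ forall c : k, chi c%:A = c, chi (Ug lambda) = (-1) ^+ s,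
      chi (Ux lambda) = 0 & chi (Uy lambda) = gamma].
Proof.
have [chi [chiE chiZ]] : exists chi : {rmorphism F -> k},
    (forall i, chi (free_gen k i) = T_char_gen i) /\
    (forall (c : k) (a : F), chi (c *: a) = c * chi a).
  pose chi : {rmorphism F -> k} := mmap idfun chi_monom.
  exists chi; split=> [i|c a]; last exact: mmap_is_linear.
  by rewrite /chi /= mmapU /chi_monom fmU big_seq1 mul1r.
have kerP a : ideal_gen (U_ideal_rel lambda) a -> chi a = 0.
  move=> /(_ [set a | chi a = 0]); apply; split; first exact: kernel_ideal.
  by apply: (@U_rel_sub_kernel _ _ _ _ _ _ _ chi s) => //; apply: chiE.
have chi_repr a : chi (repr (q a)) = chi a.
  apply/eqP; rewrite -subr_eq0 -rmorphB kerP //.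
  exact/to_quot_alg_eq/to_quot_algK.
pose f (u : U lambda) := chi (repr u).
have fD : nmod_morphism f.
  split=> [|u v].
    by rewrite /f -(to_quot_alg0 (U_ideal_rel lambda)) chi_repr rmorph0.
  rewrite -[u]to_quot_algK -[v]to_quot_algK.
  have -> : to_quot_alg _ (repr u) + to_quot_alg _ (repr v)
      = q (repr u + repr v).
    by apply: esym; apply: to_quot_algD.
  by rewrite /f !chi_repr rmorphD.
have fM : monoid_morphism f.
  split=> [|u v]; first by rewrite /f -to_quot_alg1 chi_repr rmorph1.
  rewrite -[u]to_quot_algK -[v]to_quot_algK.
  have -> : to_quot_alg _ (repr u) * to_quot_alg _ (repr v)
      = q (repr u * repr v).
    by apply: esym; apply: to_quot_algM.
  by rewrite /f !chi_repr rmorphM.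
pose fA := GRing.isNmodMorphism.Build _ _ f fD.
pose fR := GRing.isMonoidMorphism.Build _ _ f fM.
pose g : {rmorphism U lambda -> k} := HB.pack f fA fR.
have gE a : g (q a) = chi a := chi_repr a.
exists g; split=> [c|||]; [|exact: etrans (gE _) (chiE _)..].
have -> : c%:A = q c%:A := esym (to_quot_algZ (U_ideal_rel lambda) c 1).
by rewrite gE chiZ rmorph1 mulr1.
Qed.

End Character.
End Presentation.

(** * The modules T *)

Section TModules.
Variables (k : fieldType) (lambda : k) (s : bool) (gamma : k).

(** The ideal of [T_rel] is the kernel of the character of [T_char_exists], and
    modulo it each element is its own character value.  All properties of
    [T_mod] below are read off from this. *)
Lemma T_ideal_char : exists chi : {rmorphism U lambda -> k},
  [/\ forall c : k, chi c%:A = c, chi (Ug lambda) = (-1) ^+ s,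
      chi (Uy lambda) = gamma,
      forall u, ideal_gen (T_rel lambda s gamma) u -> chi u = 0
    & forall u, ideal_gen (T_rel lambda s gamma) (u - (chi u)%:A)].
Proof.
have [chi [chiC chig chix chiy]] := T_char_exists lambda s gamma.
exists chi; split=> //.
  move=> u /(_ [set a | chi a = 0]); apply; split; first exact: kernel_ideal.
  move=> r [[]|] -> /=; rewrite ?rmorphB ?rmorph_sign.
  - exact: chix.
  - by rewrite chig subrr.
  - by rewrite chiC chiy subrr.
have Jgen r : T_rel lambda s gamma r -> ideal_gen (T_rel lambda s gamma) r.
  exact: sub_gen_smallest.
have [gg' g'g _ _ _] := U_relations lambda.
have idealJ := ideal_gen_ideal (T_rel lambda s gamma).
have [JD JM JC] := mod_char_subalgebra chiC idealJ.
apply: (U_ind JD JM JC).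
- by rewrite chig sign_scalar; apply: Jgen; left; right.
- rewrite (rmorph_inverse_sign gg' chig) sign_scalar.
  apply: (inverse_sub_sign idealJ g'g).
  by apply: Jgen; left; right.
- by rewrite chix scale0r subr0; apply: Jgen; left; left.
- by rewrite chiy; apply: Jgen; right.
Qed.

(** The quotient is by a two-sided ideal, so an element kills everything as soon
    as it kills the class of [1]. *)
Lemma annihilator_T :
  annihilator (T_mod lambda s gamma) = ideal_gen (T_rel lambda s gamma).
Proof.
have [_ _ _ JMr] := ideal_gen_ideal (T_rel lambda s gamma).
apply/seteqP; split=> [r|r Jr t].
  move=> /(_ (to_quot_mod _ 1)) r1.
  rewrite -[r]subr0; apply/to_quot_mod_eq.
  by rewrite to_quot_mod0 -[r]mulr1 -quot_mod_scaleE.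
have [a ->] := to_quot_mod_surj t.
rewrite [LHS]quot_mod_scaleE -to_quot_mod0; apply/to_quot_mod_eq.
by rewrite subr0; apply: JMr.
Qed.

Lemma T_simple_dim1 :
  simple_module (T_mod lambda s gamma) /\ has_dim (T_mod lambda s gamma) 1.
Proof.
have [chi [chiC _ _ chi0 chiP]] := T_ideal_char.
apply: (@line_simple_dim1 _ _ _ (to_quot_mod (T_rel lambda s gamma) 1)).
  apply/eqP; rewrite -to_quot_mod0 => /to_quot_mod_eq.
  by rewrite subr0 => /chi0 /eqP; rewrite rmorph1 oner_eq0.
move=> t; have [a ->] := to_quot_mod_surj t; exists (chi a).
rewrite [RHS]quot_mod_scaleE mulr1; exact/to_quot_mod_eq.
Qed.

(** Evaluation at a nonzero vector [v] factors through [T_mod].  It is onto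
    since [v] generates [M], and injective since [a *: v = (chi a)%:A *: v]. *)
Lemma simple_isomorphic_T (M : lmodType (U lambda)) :
  simple_module M -> T_rel lambda s gamma `<=` annihilator M ->
  isomorphic M (T_mod lambda s gamma).
Proof.
move=> simM TM; have [[v v_neq0] _] := simM.
have [chi [chiC _ _ chi0 chiP]] := T_ideal_char.
have JM : ideal_gen (T_rel lambda s gamma) `<=` annihilator M.
  by move=> r; apply; split=> //; apply: annihilator_ideal.
pose f (t : T_mod lambda s gamma) : M := repr t *: v.
have fE a : f (to_quot_mod _ a) = a *: v.
  apply/eqP; rewrite -subr_eq0 -scalerBl; apply/eqP/JM/to_quot_mod_eq.
  exact: to_quot_modK.
have f_lin : linear f.
  move=> r t u; have [a ->] := to_quot_mod_surj t.
  have [b ->] := to_quot_mod_surj u.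
  have -> : r *: to_quot_mod (T_rel lambda s gamma) a + to_quot_mod _ b
      = to_quot_mod _ (r * a + b).
    by rewrite to_quot_modD -quot_mod_scaleE.
  by rewrite !fE scalerDl scalerA.
pose F : {linear T_mod lambda s gamma -> M} :=
  HB.pack f (GRing.isLinear.Build _ _ _ _ f f_lin).
have /choice [h hK] : forall m, exists t, f t = m.
  move=> m; have [r ->] := simple_cyclic simM v_neq0 m.
  by exists (to_quot_mod _ r); rewrite fE.
have fI : injective F.
  move=> t u /eqP; rewrite -subr_eq0 -linearB => ftu.
  apply/eqP; rewrite -subr_eq0; move: ftu.
  have [a ->] := to_quot_mod_surj (t - u).
  rewrite [F _]fE => av; rewrite -to_quot_mod0; apply/eqP/to_quot_mod_eq.
  have chia : chi a = 0.
    apply: (scalar_eq0 v_neq0).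
    by rewrite -(scaleB_eq0 (JM _ (chiP a) v)); apply/eqP.
  by have := chiP a; rewrite chia scale0r.
have fK : cancel F h by move=> t; apply: fI; exact: hK.
pose H : {linear M -> T_mod lambda s gamma} :=
  HB.pack h (GRing.isLinear.Build _ _ _ _ h (can2_linear fK hK)).
by exists H; exists F.
Qed.

Lemma simple_annihilated_dim1 (M : lmodType (U lambda)) :
  simple_module M -> T_rel lambda s gamma `<=` annihilator M -> has_dim M 1.
Proof.
move=> simM TM; have [[v v_neq0] _] := simM.
have [chi [_ _ _ _ chiP]] := T_ideal_char.
suff vP m : exists c : k, m = c%:A *: v.
  by have [] := line_simple_dim1 v_neq0 vP.
have [r ->] := simple_cyclic simM v_neq0 m; exists (chi r).
apply: scaleB_eq0; apply: (chiP r (annihilator M)); split=> //.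
exact: annihilator_ideal.
Qed.

End TModules.

(** The annihilator recovers the parameters, as the values at [g] and [y] of the
    character whose kernel it is. *)
Lemma T_isomorphic_inj (k : fieldType) (lambda : k) (s s' : bool)
    (gamma gamma' : k) :
    [pchar k] =i pred0 ->
    isomorphic (T_mod lambda s gamma) (T_mod lambda s' gamma') ->
  s = s' /\ gamma = gamma'.
Proof.
move=> char_k iso.
have JJ' := etrans (esym (annihilator_T lambda s gamma))
  (etrans (isomorphic_annihilator iso) (annihilator_T lambda s' gamma')).
have [chi [chiC chig chiy chi0 _]] := T_ideal_char lambda s' gamma'.
have chi_rel r : T_rel lambda s gamma r -> chi r = 0.
  by move=> rT; apply: chi0; rewrite -JJ'; apply: sub_gen_smallest.
split.
  have /rmorphB_eq0 : chi (Ug lambda - (-1) ^+ s) = 0.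
    by apply: chi_rel; left; right.
  by rewrite rmorph_sign chig => /(sign_inj char_k).
have /rmorphB_eq0 : chi (Uy lambda - gamma%:A) = 0 by apply: chi_rel; right.
by rewrite chiC chiy.
Qed.

(** * The relations acting on a module *)

Section RelationsOnModule.
Variables (k : fieldType) (lambda : k) (A : algType k) (g g' x y : A).
Hypotheses (char_k : [pchar k] =i pred0) (lambda_neq0 : lambda != 0).
Hypotheses (gg' : g * g' = 1) (g'g : g' * g = 1).
Hypotheses (gxg' : g * x * g' = x) (gyg' : g * y * g' = y + x).
Hypothesis yx :
  y * x - x * y = - (2%:R^-1 *: x ^+ 2) + lambda *: (1 - g ^+ 2).

Lemma comm_gx : GRing.comm g x.
Proof. by rewrite /GRing.comm -{2}gxg' -mulrA g'g mulr1. Qed.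

Lemma comm_g'x : GRing.comm g' x.
Proof. by rewrite /GRing.comm -{1}gxg' mulrA mulrA g'g mul1r. Qed.

Lemma ad_y_g : ad y g = - (x * g).
Proof.
have gy : g * y = (y + x) * g by rewrite -gyg' -!mulrA g'g mulr1.
by rewrite /ad gy mulrDl opprD addrA subrr add0r.
Qed.

Lemma ad_y_g_ideal (J : set A) : two_sided_ideal J -> J x -> J (ad y g).
Proof.
by move=> [_ _ JMl JMr] Jx; rewrite ad_y_g -mulNr -mulN1r; apply/JMr/JMl.
Qed.

Lemma comm_x_ad : GRing.comm x (ad y x).
Proof.
rewrite /ad yx; apply: commrD.
  by rewrite /GRing.comm mulrN mulNr -scalerAr -scalerAl -exprS -exprSr.
rewrite /GRing.comm -scalerAr -scalerAl; congr (_ *: _).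
by apply: commrB; [apply: commr1|apply/commrX/commr_sym/comm_gx].
Qed.

Variable M : lmodType A.
Implicit Types v w : M.

(** The largest subspace on which [x] vanishes and [g^2] is the identity: modulo
    [x] and [1 - g^2] all the relations say that the generators commute and that
    [g^2 = 1].  It is stable under the generators, hence for [U] it is the whole
    of a simple module as soon as it is nonzero. *)
Definition x_g2_kernel : set M :=
  [set w | x *: w = 0 /\ (1 - g ^+ 2) *: w = 0].

Lemma x_g2_kernel_g w : x_g2_kernel w -> x_g2_kernel (g *: w).
Proof.
move=> [xw gw]; split; rewrite scalerA.
  by rewrite -comm_gx -scalerA xw scaler0.
have -> : (1 - g ^+ 2) * g = g * (1 - g ^+ 2).
  by rewrite mulrBl mulrBr mulr1 mul1r -exprS -exprSr.
by rewrite -scalerA gw scaler0.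
Qed.

Lemma x_g2_kernel_g' w : x_g2_kernel w -> x_g2_kernel (g' *: w).
Proof.
move=> [xw gw]; split; rewrite scalerA.
  by rewrite -comm_g'x -scalerA xw scaler0.
have -> : (1 - g ^+ 2) * g' = g' * (1 - g ^+ 2).
  rewrite mulrBl mulrBr mulr1 mul1r expr2 -mulrA gg' mulr1.
  by rewrite mulrA g'g mul1r.
by rewrite -scalerA gw scaler0.
Qed.

Lemma x_g2_kernel_x w : x_g2_kernel w -> x_g2_kernel (x *: w).
Proof. by move=> [-> _]; split; rewrite scaler0. Qed.

Lemma x_g2_kernel_y w : x_g2_kernel w -> x_g2_kernel (y *: w).
Proof.
move=> [xw gw]; split; rewrite scalerA.
  have -> : x * y = y * x - (- (2%:R^-1 *: x ^+ 2) + lambda *: (1 - g ^+ 2)).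
    by rewrite -yx opprB addrC subrK.
  have -> : - (2%:R^-1 *: x ^+ 2) + lambda *: (1 - g ^+ 2)
      = - 2%:R^-1 *: x * x + lambda%:A * (1 - g ^+ 2).
    by rewrite scaleNr mulNr -scalerAl expr2 -scalerAl mul1r.
  by rewrite scalerBl scalerDl -!scalerA xw gw !scaler0 addr0 subrr.
have -> : (1 - g ^+ 2) * y = y * (1 - g ^+ 2) - (g * g + g * g) * x.
  have gy : g * y = y * g + x * g by rewrite -mulrDl -gyg' -!mulrA g'g mulr1.
  rewrite mulrBl mulrBr mul1r mulr1 -addrA -opprD; congr (_ - _).
  rewrite expr2 -mulrA gy mulrDr !mulrA gy mulrDl -!mulrA -addrA; congr (_ + _).
  by rewrite mulrDl mulrA -!comm_gx -!mulrA -comm_gx.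
by rewrite scalerBl -!scalerA xw gw !scaler0 subrr.
Qed.

(** Both [g] and [x] commute with their commutators with [y], so these
    commutators [-xg] and [-x^2/2 + lambda (1 - g^2)] act nilpotently.  Hence
    [xg], and with it [x], kills some nonzero vector; on the vectors killed by
    [x] the second commutator is [lambda (1 - g^2)], and it too kills one of
    them. *)
Lemma x_g2_kernel_neq0 v :
  finite_dim M -> v != 0 -> exists w, w != 0 /\ x_g2_kernel w.
Proof.
move=> fdM v_neq0.
have annI := annihilator_ideal M.
have [p p_neq0 pg] := algebraic_finite_dim g fdM.
have [p' p'_neq0 p'x] := algebraic_finite_dim x fdM.
have comm_g_ad : GRing.comm g (ad y g).
  by rewrite ad_y_g; apply/commrN/commrM => //; apply: comm_gx.
have [n nil_g] := nilpotent_ad char_k annI comm_g_ad p_neq0 pg.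
have [n' nil_x] := nilpotent_ad char_k annI comm_x_ad p'_neq0 p'x.
have [j [w_neq0]] := nilpotent_kernel_vector v_neq0 (nil_g v).
set w := _ *: v in w_neq0 * => adw.
have xw : x *: w = 0.
  move: adw; rewrite ad_y_g -comm_gx => /(congr1 ( *:%R (- g'))).
  by rewrite scaler0 scalerA mulrNN mulrA g'g mul1r.
have [i [u_neq0]] := nilpotent_kernel_vector w_neq0 (nil_x w).
set u := _ *: w in u_neq0 * => adu.
have xu : x *: u = 0.
  have -> : x *: u = ad y x ^+ i *: (x *: w).
    by rewrite /u !scalerA (commrX i comm_x_ad).
  by rewrite xw scaler0.
exists u; split=> //; split=> //.
rewrite -[LHS](scalarK _ lambda_neq0).
suff -> : lambda%:A *: ((1 - g ^+ 2) *: u) = 0 by rewrite scaler0.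
have -> : lambda%:A *: ((1 - g ^+ 2) *: u)
    = (ad y x + 2%:R^-1 *: x * x) *: u.
  rewrite scalerA -scalerAl mul1r; congr (_ *: _).
  by rewrite /ad yx expr2 scalerAl addrAC addNr add0r.
by rewrite scalerDl adu add0r -scalerA xu scaler0.
Qed.

(** If [(1 + g) v] is zero, then [v] has eigenvalue [-1]; otherwise [(1 + g) v]
    is fixed by [g]. *)
Lemma sign_eigenvector v : v != 0 -> (1 - g ^+ 2) *: v = 0 ->
  exists (s : bool) w, w != 0 /\ g *: w = ((-1) ^+ s)%:A *: w.
Proof.
move=> v_neq0 gv; have [/eqP w0|w_neq0] := boolP ((1 + g) *: v == 0).
  exists true, v; split=> //; apply/eqP.
  rewrite expr1 scaleN1r scaleNr scale1r -addr_eq0 -{2}[v]scale1r -scalerDl.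
  by rewrite addrC w0.
exists false, ((1 + g) *: v); split=> //; apply/eqP.
rewrite expr0 !scale1r -subr_eq0 -oppr_eq0 opprB -{1}[_ *: v]scale1r -scalerBl.
have -> : (1 - g) *: ((1 + g) *: v) = (1 - g ^+ 2) *: v.
  by rewrite scalerA mulrDr mulr1 mulrBl mul1r -expr2 addrA subrK.
by rewrite gv.
Qed.

End RelationsOnModule.

(** * Finite-dimensional simple modules *)

Lemma simple_x_g2_kernel (k : fieldType) (lambda : k)
    (M : lmodType (U lambda)) :
    [pchar k] =i pred0 -> lambda != 0 -> simple_module M -> finite_dim M ->
  forall m : M, x_g2_kernel (Ug lambda) (Ux lambda) m.
Proof.
move=> char_k lambda_neq0 [[v v_neq0] simM] fdM m.
have [gg' g'g gx gy yx] := U_relations lambda.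
have [w [w_neq0 Nw]] :=
  x_g2_kernel_neq0 char_k lambda_neq0 g'g gx gy yx fdM v_neq0.
set N := @x_g2_kernel _ _ _ _ M in Nw *.
have subN : submodule N.
  apply: U_submodule.
  - by split; rewrite scaler0.
  - move=> u u' [xu gu] [xu' gu'].
    by split; rewrite scalerDr ?xu ?gu ?xu' ?gu' addr0.
  - move=> c u [xu gu]; split.
      by rewrite scale_scalarC xu scaler0.
    by rewrite scale_scalarC gu scaler0.
  - exact: (x_g2_kernel_g g'g gx).
  - exact: (x_g2_kernel_g' gg' g'g gx).
  - exact: x_g2_kernel_x.
  - exact: (x_g2_kernel_y g'g gx gy yx).
have [N0|NT] := simM _ subN.
  by move: Nw; rewrite N0 => w0; rewrite w0 eqxx in w_neq0.
by have : [set: M] m by []; rewrite -NT.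
Qed.

(** As [x] and [1 - g^2] act by zero, [g] and [y] are central modulo the
    annihilator, so an eigenvector of each makes it a scalar; for [g] the scalar
    is a sign. *)
Lemma simple_annihilated_by_T_rel (k : closedFieldType) (lambda : k)
    (M : lmodType (U lambda)) :
    [pchar k] =i pred0 -> lambda != 0 -> simple_module M -> finite_dim M ->
  exists s gamma, T_rel lambda s gamma `<=` annihilator M.
Proof.
move=> char_k lambda_neq0 simM fdM.
have Mkernel := simple_x_g2_kernel char_k lambda_neq0 simM fdM.
have [gg' g'g gx gy yx] := U_relations lambda.
have [[v v_neq0] _] := simM.
have annI := annihilator_ideal M.
have Jx : annihilator M (Ux lambda) by move=> m; have [] := Mkernel m.
have ad_yg := ad_y_g_ideal g'g gy annI Jx.
have central r : annihilator M (ad r (Ug lambda)) ->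
    annihilator M (ad r (Uy lambda)) ->
  forall u, annihilator M (ad r u).
  move=> rg ry; have [JD JM JC] := ad_mod_subalgebra r annI.
  apply: (U_ind JD JM JC); [exact: rg| | |exact: ry].
    exact: (ad_idealV annI gg' g'g rg).
  exact: (ad_ideal annI r Jx).
have g_central := central _ (ad_ideal_self annI _) (ad_idealC annI ad_yg).
have y_central := central _ ad_yg (ad_ideal_self annI _).
have [s [w [w_neq0 gw]]] := sign_eigenvector v_neq0 (Mkernel v).2.
have [p p_neq0 py] := algebraic_finite_dim (Uy lambda) fdM.
have [gamma [u [u_neq0 yu]]] := eigenvector v_neq0 p_neq0 (py v).
exists s, gamma => r [[]|] -> //.
  by rewrite -sign_scalar; apply: (central_scalar simM g_central w_neq0 gw).
exact: (central_scalar simM y_central u_neq0 yu).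
Qed.

Theorem corollary4p8 (k : closedFieldType) (char_k : [pchar k] =i pred0)
    (lambda : k) (lambda_neq0 : lambda != 0) :
  [/\ forall (s : bool) (gamma : k),
        simple_module (T_mod lambda s gamma) /\
        finite_dim (T_mod lambda s gamma),
      forall (s s' : bool) (gamma gamma' : k),
        isomorphic (T_mod lambda s gamma) (T_mod lambda s' gamma') ->
        s = s' /\ gamma = gamma',
      forall M : lmodType (U lambda), simple_module M -> finite_dim M ->
        exists (s : bool) (gamma : k), isomorphic M (T_mod lambda s gamma),
      forall (s : bool) (gamma : k),
        annihilator (T_mod lambda s gamma) = ideal_gen (T_rel lambda s gamma)
    & forall M : lmodType (U lambda), simple_module M -> finite_dim M ->
        has_dim M 1].
Proof.
split.
- move=> s gamma; have [simT dimT] := T_simple_dim1 lambda s gamma.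
  by split=> //; exists 1%N.
- move=> s s' gamma gamma'; exact: T_isomorphic_inj.
- move=> M simM fdM.
  have [s [gamma TM]] :=
    simple_annihilated_by_T_rel char_k lambda_neq0 simM fdM.
  by exists s, gamma; apply: simple_isomorphic_T.
- exact: annihilator_T.
move=> M simM fdM.
have [s [gamma TM]] := simple_annihilated_by_T_rel char_k lambda_neq0 simM fdM.
exact: simple_annihilated_dim1 simM TM.
Qed.
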